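(* Let $I$ be a non-empty set and let $E\subseteq\mathbb{R}^I$ be a linear subspace containing all $e_i$ ($i\in I$), endowed with a complete absolute normalised norm $\|\cdot\|_E$ such that $\operatorname{span}\{e_i:i\in I\}$ is dense in $E$. If $(X_i)_{i\in I}$ is a family of $\mathrm{sluacs}^+$ (resp. $\mathrm{luacs}^+$) Banach spaces and $E$ is $\mathrm{sluacs}^+$ (in both cases), then $\bigl[\bigoplus_{i\in I}X_i\bigr]_E$ is $\mathrm{sluacs}^+$ (resp. $\mathrm{luacs}^+$) as well.
   Context: Banach spaces are real; $S_X$ denotes the unit sphere of $X$ and $X^*$ its dual. A Banach space $X$ is called - $\mathrm{luacs}^+$ if for every $x\in S_X$, every sequence $(x_n)$ in $S_X$ with $\|x_n+x\|\to 2$ and all $x^*\in S_{X^*}$: $x^*(x_n)\to 1\iff x^*(x)=1$; - $\mathrm{sluacs}^+$ if for every $x\in S_X$, every sequence $(x_n)$ in $S_X$ with $\|x_n+x\|\to 2$ and all sequences $(x_n^* )$ in $S_{X^*}$: $x_n^*(x_n)\to 1\iff x_n^*(x)\to 1$. For a non-empty set $I$, $e_i\in\mathbb{R}^I$ denotes the characteristic function of $\{i\}$. A norm $\|\cdot\|_E$ on a subspace $E$ of $\mathbb{R}^I$ (with all $e_i\in E$) is absolute if whenever $(a_i)_{i\in I}\in E$, $(b_i)_{i\in I}\in\mathbb{R}^I$ and $|a_i|=|b_i|$ for all $i\in I$, then $(b_i)_{i\in I}\in E$ and $\|(a_i)_{i\in I}\|_E=\|(b_i)_{i\in I}\|_E$;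 it is normalised if $\|e_i\|_E=1$ for every $i\in I$. For a family $(X_i)_{i\in I}$ of Banach spaces, the absolute sum with respect to $E$ is $\bigl[\bigoplus_{i\in I}X_i\bigr]_E=\{(x_i)_{i\in I}\in\prod_{i\in I}X_i:(\|x_i\|)_{i\in I}\in E\}$ with the norm $\|(x_i)_{i\in I}\|_E=\|(\|x_i\|)_{i\in I}\|_E$; it is a Banach space. *)

(* Defs.v *)
From HB Require Import structures.
From mathcomp Require Import all_boot all_order all_algebra.
From mathcomp Require Import all_classical all_reals all_analysis.
From mathcomp Require Import ring lra.

Set Implicit Arguments.
Unset Strict Implicit.
Unset Printing Implicit Defensive.

Import Order.TTheory GRing.Theory Num.Theory.
Import numFieldNormedType.Exports.

Local Open Scope classical_set_scope.
Local Open Scope ring_scope.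

Section acs_properties.
Context {R : realType} (X : completeNormedModType R).

Definition unit_sphere : set X := [set x | `|x| = 1].

(* The operator norm of f when f is continuous; [sup] is 0 on unbounded sets. *)
Definition dual_norm (f : {linear X -> R^o}) : R :=
  sup [set `|f x| | x in [set x : X | `|x| <= 1]].

Definition dual_sphere : set {linear X -> R^o} :=
  [set f : {linear X -> R^o} | continuous f /\ dual_norm f = 1].

Definition luacs_plus : Prop :=
  forall (x : X) (u : nat -> X),
    unit_sphere x -> (forall n, unit_sphere (u n)) ->
    `|u n + x| @[n --> \oo] --> (2 : R) ->
    forall f : {linear X -> R^o}, dual_sphere f ->
      (f (u n) @[n --> \oo] --> (1 : R)) <-> f x = 1.

Definition sluacs_plus : Prop :=
  forall (x : X) (u : nat -> X),
    unit_sphere x -> (forall n, unit_sphere (u n)) ->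
    `|u n + x| @[n --> \oo] --> (2 : R) ->
    forall f : nat -> {linear X -> R^o}, (forall n, dual_sphere (f n)) ->
      (f n (u n) @[n --> \oo] --> (1 : R)) <->
      (f n x @[n --> \oo] --> (1 : R)).

End acs_properties.

(* A linear subspace of R^I containing every e_i = \1_[set i], with a complete
   absolute normalised norm. [norm_fun] is only meaningful on [carrier]. *)
Record abs_normed (R : realType) (I : Type) := AbsNormed {
  carrier : set (I -> R);
  norm_fun : (I -> R) -> R;
  carrier0 : carrier 0;
  carrierD : forall a b, carrier a -> carrier b -> carrier (a + b);
  carrierZ : forall (c : R) a, carrier a -> carrier (c *: a);
  norm_funD : forall a b, carrier a -> carrier b ->
    norm_fun (a + b) <= norm_fun a + norm_fun b;
  norm_funZ : forall (c : R) a, carrier a ->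
    norm_fun (c *: a) = `|c| * norm_fun a;
  norm_fun_eq0 : forall a, carrier a -> norm_fun a = 0 -> a = 0;
  carrier_unit : forall i, carrier \1_[set i];
  norm_fun_absolute : forall a b : I -> R, carrier a ->
    (forall i, `|a i| = `|b i|) -> carrier b /\ norm_fun a = norm_fun b;
  norm_fun_normalised : forall i, norm_fun \1_[set i] = 1;
  norm_fun_complete : forall u : nat -> I -> R, (forall n, carrier (u n)) ->
    (forall e : R, 0 < e -> exists N, forall m n, (N <= m)%N -> (N <= n)%N ->
       norm_fun (u m - u n) <= e) ->
    exists2 a, carrier a &
      forall e : R, 0 < e -> exists N, forall n, (N <= n)%N ->
        norm_fun (u n - a) <= e
}.

Record abs_space (R : realType) (I : Type) (E : abs_normed R I) := AbsSpace {
  abs_fun :> I -> R;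
  abs_funP : carrier E abs_fun
}.

Section abs_space_structure.
Context (R : realType) (I : Type) (E : abs_normed R I).
Implicit Types a b : abs_space E.

Lemma abs_fun_inj : injective (@abs_fun R I E).
Proof.
by move=> [a aE] [b bE] /= ab; subst b; rewrite (Prop_irrelevance aE bE).
Qed.

HB.instance Definition _ := gen_eqMixin (abs_space E).
HB.instance Definition _ := gen_choiceMixin (abs_space E).

Definition abs_zero : abs_space E := AbsSpace (carrier0 E).
Definition abs_add a b : abs_space E :=
  AbsSpace (carrierD (abs_funP a) (abs_funP b)).
Definition abs_scale (c : R) a : abs_space E :=
  AbsSpace (carrierZ c (abs_funP a)).
Definition abs_opp a : abs_space E := abs_scale (-1) a.

Fact abs_addA : associative abs_add.
Proof. by move=> a b c; apply: abs_fun_inj; exact: addrA. Qed.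
Fact abs_addC : commutative abs_add.
Proof. by move=> a b; apply: abs_fun_inj; exact: addrC. Qed.
Fact abs_add0 : left_id abs_zero abs_add.
Proof. by move=> a; apply: abs_fun_inj; exact: add0r. Qed.
Fact abs_addN : left_inverse abs_zero abs_opp abs_add.
Proof. by move=> a; apply: abs_fun_inj; rewrite /= scaleN1r addNr. Qed.
HB.instance Definition _ := GRing.isZmodule.Build (abs_space E)
  abs_addA abs_addC abs_add0 abs_addN.

Fact abs_scaleA c d a : abs_scale c (abs_scale d a) = abs_scale (c * d) a.
Proof. by apply: abs_fun_inj; exact: scalerA. Qed.
Fact abs_scale1 : left_id 1 abs_scale.
Proof. by move=> a; apply: abs_fun_inj; exact: scale1r. Qed.
Fact abs_scaleDr : right_distributive abs_scale +%R.
Proof. by move=> c a b; apply: abs_fun_inj; exact: scalerDr. Qed.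
Fact abs_scaleDl a : {morph abs_scale^~ a : c d / c + d}.
Proof. by move=> c d; apply: abs_fun_inj; exact: scalerDl. Qed.
HB.instance Definition _ := GRing.Zmodule_isLmodule.Build R (abs_space E)
  abs_scaleA abs_scale1 abs_scaleDr abs_scaleDl.

Lemma abs_fun_add a b : abs_fun (a + b) = abs_fun a + abs_fun b.
Proof. by []. Qed.
Lemma abs_fun_scale (c : R) a : abs_fun (c *: a) = c *: abs_fun a.
Proof. by []. Qed.
Lemma abs_fun_opp a : abs_fun (- a) = - abs_fun a.
Proof. by rewrite -scaleN1r abs_fun_scale scaleN1r. Qed.
Lemma abs_fun_sub a b : abs_fun (a - b) = abs_fun a - abs_fun b.
Proof. by rewrite abs_fun_add abs_fun_opp. Qed.

Definition abs_norm a : R := norm_fun E a.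

Fact abs_norm_triangle a b : abs_norm (a + b) <= abs_norm a + abs_norm b.
Proof. exact: norm_funD (abs_funP a) (abs_funP b). Qed.
Fact abs_normZ (c : R) a : abs_norm (c *: a) = `|c| * abs_norm a.
Proof. exact: norm_funZ (abs_funP a). Qed.
Fact abs_norm_eq0 a : abs_norm a = 0 -> a = 0.
Proof. by move=> /(norm_fun_eq0 (abs_funP a)) a0; exact: abs_fun_inj. Qed.
HB.instance Definition _ := Lmodule_isNormed.Build R (abs_space E)
  abs_norm_triangle abs_normZ abs_norm_eq0.

Lemma abs_normE a : `|a| = norm_fun E a.
Proof. by []. Qed.

Fact abs_space_complete (F : set_system (abs_space E)) :
  ProperFilter F -> cauchy F -> cvg F.
Proof.
move=> FF /cauchyP Fc.
pose eps (n : nat) : R := n.+1%:R^-1.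
have eps0 n : 0 < eps n by rewrite invr_gt0 ltr0Sn.
have /choice [u Fu] : forall n, exists x, F (ball x (eps n)).
  by move=> n; exact: Fc.
have uc m n : `|u m - u n| <= eps m + eps n.
  have [z [zm zn]] := filter_ex (filterI (Fu m) (Fu n)).
  move: zm zn; rewrite -ball_normE /= => zm zn.
  rewrite (_ : u m - u n = (u m - z) - (u n - z)).
    by rewrite (le_trans (ler_normB _ _))// lerD// ltW.
  by rewrite opprB addrA subrK.
have epsN (e : R) : 0 < e -> exists N, forall n, (N <= n)%N -> eps n < e.
  by move=> e0; have [N _ NP] := near_infty_natSinv_lt (PosNum e0);
    exists N => n; exact: NP.
have [||a aE ua] := @norm_fun_complete _ _ E (fun n => abs_fun (u n)).
- by move=> n; exact: abs_funP.
- move=> e e0; have [N NP] := epsN (e / 2) ltac:(by rewrite divr_gt0).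
  exists N => m n /NP me /NP ne.
  rewrite -abs_fun_sub -abs_normE (le_trans (uc m n))//.
  by rewrite [e]splitr lerD// ltW.
apply/cvg_ex; exists (AbsSpace aE).
apply/cvgrPdist_lt => e e0.
have [N1 N1P] := ua (e / 2) ltac:(by rewrite divr_gt0).
have [N2 N2P] := epsN (e / 2) ltac:(by rewrite divr_gt0).
pose n := maxn N1 N2.
apply: filterS (Fu n) => z; rewrite -ball_normE /= => zn.
have := N1P n (leq_maxl _ _).
have -> : abs_fun (u n) - a = abs_fun (u n - AbsSpace aE).
  by rewrite abs_fun_sub.
rewrite -abs_normE => an.
rewrite (_ : _ - z = (u n - z) - (u n - AbsSpace aE)).
  rewrite (le_lt_trans (ler_normB _ _))// [e]splitr ltr_leD//.
  by rewrite (lt_trans zn)// N2P// leq_maxr.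
by rewrite opprB [RHS]addrC addrA subrK.
Qed.
HB.instance Definition _ :=
  Uniform_isComplete.Build (abs_space E) abs_space_complete.

Definition abs_unit (i : I) : abs_space E := AbsSpace (carrier_unit E i).

Definition unit_span : set (abs_space E) :=
  [set a | exists (s : seq I) (c : I -> R), a = \sum_(i <- s) c i *: abs_unit i].

End abs_space_structure.
Arguments unit_span {R I} E.

Section abs_space_order.
Context (R : realType) (I : Type) (E : abs_normed R I).

Lemma abs_coord_le (a : abs_space E) i : `|a i| <= `|a|.
Proof.
pose b j := if `[< i = j >] then a j else - a j.
have [bE bn] : carrier E b /\ norm_fun E a = norm_fun E b.
  apply: norm_fun_absolute (abs_funP a) _ => j.
  by rewrite /b; case: ifP => // _; rewrite normrN.
have ab : a i *: abs_unit E i = (1 / 2) *: (a + AbsSpace bE).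
  apply: abs_fun_inj; apply/funext => j.
  change (a i * \1_[set i] j = 1 / 2 * (a j + b j)).
  rewrite indicE /b; have [<-|ij] := asboolP (i = j).
    by rewrite mem_set//=; lra.
  by rewrite memNset ?subrr ?mulr0 ?mulr0n ?mulr0// => ji; exact: ij.
have : `|a i *: abs_unit E i| <= `|a|.
  rewrite ab normrZ ger0_norm ?divr_ge0//.
  have := ler_normD a (AbsSpace bE).
  by rewrite [`|AbsSpace bE|]abs_normE -[norm_fun E _]bn -abs_normE; lra.
by rewrite normrZ [`|abs_unit _ _|]norm_fun_normalised mulr1.
Qed.

(* The partial sums of a binary expansion of a with respect to b, all of whose
   increments have absolute value proportional to |b|. *)
Fixpoint dyadic_approx (a b : I -> R) (n : nat) : I -> R :=
  if n is m.+1 then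
    dyadic_approx a b m +
      (2^-1 ^+ n) *: (fun i => if dyadic_approx a b m i <= a i
                               then `|b i| else - `|b i|)
  else 0.

Lemma abs_solid (a : I -> R) (b : abs_space E) :
  (forall i, `|a i| <= `|b i|) -> carrier E a /\ norm_fun E a <= `|b|.
Proof.
move=> ab; pose c := dyadic_approx a b.
pose d n : I -> R := fun i => if c n i <= a i then `|b i| else - `|b i|.
have cS n : c n.+1 = c n + (2^-1 ^+ n.+1) *: d n by [].
have dP n : carrier E (d n) /\ norm_fun E b = norm_fun E (d n).
  apply: norm_fun_absolute (abs_funP b) _ => i.
  by rewrite /d; case: ifP => _; rewrite ?normrN normr_id.
have cE n : carrier E (c n).
  elim: n => [|n IH]; first exact: carrier0.
  by rewrite cS; apply: carrierD => //; apply: carrierZ; case: (dP n).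
have hS n : (2^-1 : R) ^+ n = 2 * 2^-1 ^+ n.+1.
  by rewrite exprS mulrA divff// mul1r.
have cb n i : `|a i - c n i| <= 2^-1 ^+ n * `|b i|.
  elim: n => [|n].
    by rewrite expr0 mul1r (_ : c 0%N i = 0)// subr0.
  have -> : c n.+1 i = c n i + 2^-1 ^+ n.+1 * d n i by [].
  rewrite hS; set t := _ ^+ n.+1.
  have t0 : 0 <= t * `|b i| by rewrite mulr_ge0// exprn_ge0// invr_ge0.
  rewrite -mulrA !ler_norml /d; case: ifPn => [|]; rewrite -?ltNge ?mulrN;
    by move=> h /andP[h1 h2]; apply/andP; split; lra.
pose C n : abs_space E := AbsSpace (cE n).
have CS n : C n.+1 = C n + 2^-1 ^+ n.+1 *: AbsSpace (proj1 (dP n)).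
  exact: abs_fun_inj.
have nD n : `|AbsSpace (proj1 (dP n))| = `|b|.
  by rewrite !abs_normE /=; case: (dP n) => _ ->.
have Cstep n k : `|C (n + k)%N - C n| <= (2^-1 ^+ n - 2^-1 ^+ (n + k)) * `|b|.
  elim: k => [|k IH]; first by rewrite addn0 !subrr normr0 mul0r.
  rewrite addnS CS addrAC (le_trans (ler_normD _ _))//.
  rewrite normrZ nD ger0_norm ?exprn_ge0 ?invr_ge0//.
  by move: IH; rewrite (hS (n + k)%N); nra.
have Cle n k : `|C (n + k)%N - C n| <= 2^-1 ^+ n * `|b|.
  rewrite (le_trans (Cstep n k))// ler_wpM2r// lerBlDr lerDl.
  by rewrite exprn_ge0// invr_ge0.
have Ccauchy : cauchy (C n @[n --> \oo]).
  apply: cauchy_exP => e e0.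
  have h0 : (2^-1 : R) ^+ n * `|b| @[n --> \oo] --> (0 : R).
    rewrite -[X in _ --> X](mul0r `|b|); apply: cvgMr_tmp.
    by apply: cvg_expr; rewrite ger0_norm ?invr_ge0// invf_lt1// ltr1n.
  have /cvgrPdist_lt/(_ e e0)[N _ NP] := h0.
  exists (C N); exists N => // n /= Nn.
  rewrite -ball_normE /= distrC -(subnKC Nn) (le_lt_trans (Cle _ _))//.
  have bN : 0 <= (2^-1 : R) ^+ N * `|b| by rewrite mulr_ge0// exprn_ge0// invr_ge0.
  by have := NP N (leqnn N); rewrite sub0r normrN (ger0_norm bN).
have : C n @[n --> \oo] --> lim (C n @[n --> \oo]) by exact: cauchy_cvg.
move: (lim _) => c0 Cc0.
have ac0 : a = abs_fun c0.
  apply/funext => i.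
  have h0 : (2^-1 : R) ^+ n * `|b i| @[n --> \oo] --> (0 : R).
    rewrite -[X in _ --> X](mul0r `|b i|); apply: cvgMr_tmp.
    by apply: cvg_expr; rewrite ger0_norm ?invr_ge0// invf_lt1// ltr1n.
  have h1 : c n i @[n --> \oo] --> a i.
    apply/cvgrPdist_le => e e0.
    move/cvgrPdist_le : h0 => /(_ e e0); apply: filterS => n.
    rewrite sub0r normrN ger0_norm ?mulr_ge0 ?exprn_ge0 ?invr_ge0//.
    exact: le_trans.
  have h2 : c n i @[n --> \oo] --> c0 i.
    apply/cvgrPdist_le => e e0.
    move/cvgrPdist_le : Cc0 => /(_ e e0); apply: filterS => n.
    apply: le_trans.
    by have := abs_coord_le (c0 - C n) i; rewrite abs_fun_sub.
  exact: (cvg_unique _ h1 h2).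
rewrite ac0; split; first exact: abs_funP.
rewrite -abs_normE; apply: (cvgr_to_le (cvg_norm Cc0)).
apply: nearW => n; have := Cle 0%N n.
by rewrite (_ : C 0%N = 0) ?subr0 ?expr0 ?mul1r//; exact: abs_fun_inj.
Qed.

End abs_space_order.

Record abs_sum (R : realType) (I : Type) (E : abs_normed R I)
    (X : I -> completeNormedModType R) := AbsSum {
  sum_fun :> forall i, X i;
  sum_funP : carrier E (fun i => `|sum_fun i|)
}.

Section abs_sum_structure.
Context (R : realType) (I : Type) (E : abs_normed R I).
Context (X : I -> completeNormedModType R).
Implicit Types x y : abs_sum E X.

Lemma sum_fun_ext x y : (forall i, x i = y i) -> x = y.
Proof.
case: x y => [x xE] [y yE] /= xy.
have {}xy : x = y by exact: functional_extensionality_dep.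
by subst y; rewrite (Prop_irrelevance xE yE).
Qed.

HB.instance Definition _ := gen_eqMixin (abs_sum E X).
HB.instance Definition _ := gen_choiceMixin (abs_sum E X).

Definition sum_nrm x : abs_space E := AbsSpace (sum_funP x).

Fact sum_zeroP : carrier E (fun i => `|0 : X i|).
Proof.
rewrite (_ : (fun _ => _) = 0); first exact: carrier0.
by apply/funext => i; rewrite normr0.
Qed.
Definition sum_zero : abs_sum E X := AbsSum sum_zeroP.

Fact sum_add_le x y i :
  `| `|x i + y i| | <= `|(sum_nrm x + sum_nrm y : abs_space E) i|.
Proof.
rewrite normr_id [abs_fun _ i]/(`|x i| + `|y i|) [leRHS]ger0_norm ?addr_ge0//.
exact: ler_normD.
Qed.
Fact sum_addP x y : carrier E (fun i => `|x i + y i|).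
Proof. exact: proj1 (abs_solid (sum_add_le x y)). Qed.
Definition sum_add x y : abs_sum E X := AbsSum (sum_addP x y).

Fact sum_scaleP (c : R) x : carrier E (fun i => `|c *: x i|).
Proof.
have h i : `| `|c *: x i| | <= `|(c *: sum_nrm x : abs_space E) i|.
  by rewrite normrZ [leRHS]normrM normrM !normr_id.
exact: proj1 (abs_solid h).
Qed.
Definition sum_scale (c : R) x : abs_sum E X := AbsSum (sum_scaleP c x).
Definition sum_opp x : abs_sum E X := sum_scale (-1) x.

Fact sum_addA : associative sum_add.
Proof. by move=> x y z; apply: sum_fun_ext => i; exact: addrA. Qed.
Fact sum_addC : commutative sum_add.
Proof. by move=> x y; apply: sum_fun_ext => i; exact: addrC. Qed.
Fact sum_add0 : left_id sum_zero sum_add.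
Proof. by move=> x; apply: sum_fun_ext => i; exact: add0r. Qed.
Fact sum_addN : left_inverse sum_zero sum_opp sum_add.
Proof. by move=> x; apply: sum_fun_ext => i; rewrite /= scaleN1r addNr. Qed.
HB.instance Definition _ := GRing.isZmodule.Build (abs_sum E X)
  sum_addA sum_addC sum_add0 sum_addN.

Fact sum_scaleA c d x : sum_scale c (sum_scale d x) = sum_scale (c * d) x.
Proof. by apply: sum_fun_ext => i; exact: scalerA. Qed.
Fact sum_scale1 : left_id 1 sum_scale.
Proof. by move=> x; apply: sum_fun_ext => i; exact: scale1r. Qed.
Fact sum_scaleDr : right_distributive sum_scale +%R.
Proof. by move=> c x y; apply: sum_fun_ext => i; exact: scalerDr. Qed.
Fact sum_scaleDl x : {morph sum_scale^~ x : c d / c + d}.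
Proof. by move=> c d; apply: sum_fun_ext => i; exact: scalerDl. Qed.
HB.instance Definition _ := GRing.Zmodule_isLmodule.Build R (abs_sum E X)
  sum_scaleA sum_scale1 sum_scaleDr sum_scaleDl.

Lemma sum_fun_add x y i : (x + y) i = x i + y i.
Proof. by []. Qed.
Lemma sum_fun_scale (c : R) x i : (c *: x) i = c *: x i.
Proof. by []. Qed.
Lemma sum_fun_opp x i : (- x) i = - x i.
Proof. by rewrite -scaleN1r sum_fun_scale scaleN1r. Qed.
Lemma sum_fun_sub x y i : (x - y) i = x i - y i.
Proof. by rewrite sum_fun_add sum_fun_opp. Qed.

Definition sum_norm x : R := norm_fun E (fun i => `|x i|).

Fact sum_norm_triangle x y : sum_norm (x + y) <= sum_norm x + sum_norm y.
Proof.
apply: (le_trans (proj2 (abs_solid (sum_add_le x y)))).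
exact: (ler_normD (sum_nrm x) (sum_nrm y)).
Qed.
Fact sum_normZ (c : R) x : sum_norm (c *: x) = `|c| * sum_norm x.
Proof.
rewrite /sum_norm -[`|c|]normr_id -(norm_funZ _ (sum_funP x)); congr norm_fun.
by apply/funext => i; rewrite sum_fun_scale normrZ.
Qed.
Fact sum_norm_eq0 x : sum_norm x = 0 -> x = 0.
Proof.
move=> /(norm_fun_eq0 (sum_funP x)) x0; apply: sum_fun_ext => i.
by apply/normr0_eq0; exact: (congr1 (fun a : I -> R => a i) x0).
Qed.
HB.instance Definition _ := Lmodule_isNormed.Build R (abs_sum E X)
  sum_norm_triangle sum_normZ sum_norm_eq0.

Lemma sum_normE x : `|x| = norm_fun E (fun i => `|x i|).
Proof. by []. Qed.

Lemma sum_nrm_norm x : `|sum_nrm x| = `|x|.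
Proof. by []. Qed.

Lemma sum_coord_le x i : `|x i| <= `|x|.
Proof. by have := abs_coord_le (sum_nrm x) i; rewrite normr_id. Qed.

Lemma sum_nrm_sub x y : `|sum_nrm x - sum_nrm y| <= `|x - y|.
Proof.
have h i : `|(sum_nrm x - sum_nrm y : abs_space E) i| <= `|sum_nrm (x - y) i|.
  rewrite abs_fun_sub (_ : sum_nrm (x - y) i = `|x i - y i|); last first.
    by rewrite -sum_fun_sub.
  by rewrite normr_id; exact: ler_dist_dist.
exact: proj2 (abs_solid h).
Qed.

Fact abs_sum_complete (F : set_system (abs_sum E X)) :
  ProperFilter F -> cauchy F -> cvg F.
Proof.
move=> FF Fc.
have lip (V : completeNormedModType R) (f : abs_sum E X -> V) :
    (forall x y, `|f x - f y| <= `|x - y|) -> f x @[x --> F] --> lim (f @ F).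
  move=> fl; apply: cauchy_cvg; apply: cauchy_exP => e e0.
  move/cauchyP : Fc => /(_ e e0)[x Fx]; exists (f x).
  suff : F (f @^-1` ball (f x) e) by [].
  apply: filterS Fx => y; move: (fl x y); rewrite /= -!ball_normE /=.
  exact: le_lt_trans.
pose l i : X i := lim (x i @[x --> F]).
have lP i : x i @[x --> F] --> l i.
  by apply: lip => x y; rewrite -sum_fun_sub; exact: sum_coord_le.
have key z : exists2 b : abs_space E,
    sum_nrm (x - z) @[x --> F] --> b & forall i, b i = `|l i - z i|.
  exists (lim (sum_nrm (x - z) @[x --> F])).
    apply: lip => x y; apply: (le_trans (sum_nrm_sub _ _)).
    by rewrite opprB addrA subrK.
  move=> i; set b := lim _.
  have h1 : `|x i - z i| @[x --> F] --> b i.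
    have bP : sum_nrm (x - z) @[x --> F] --> b.
      apply: lip => x y; apply: (le_trans (sum_nrm_sub _ _)).
      by rewrite opprB addrA subrK.
    apply/cvgrPdist_le => e e0.
    move/cvgrPdist_le : bP => /(_ e e0); apply: filterS => x.
    apply: le_trans; have := abs_coord_le (b - sum_nrm (x - z)) i.
    rewrite abs_fun_sub (_ : (_ - _ : I -> R) i = b i - `|x i - z i|)//.
    by rewrite -sum_fun_sub.
  have h2 : `|x i - z i| @[x --> F] --> `|l i - z i|.
    by apply: cvg_norm; apply: cvgB (lP i) _; exact: cvg_cst.
  exact: (cvg_unique _ h1 h2).
have lE : carrier E (fun i => `|l i|).
  have [b _ bl] := key 0; rewrite (_ : (fun _ => _) = abs_fun b).
    exact: abs_funP.
  by apply/funext => i; rewrite bl subr0.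
apply/cvg_ex; exists (AbsSum lE); apply/cvgrPdist_lt => e e0.
have e20 : 0 < e / 2 by rewrite divr_gt0.
move/cauchyP : Fc => /(_ _ e20)[z Fz].
have Lz : `|AbsSum lE - z| <= e / 2.
  have [b bP bl] := key z.
  rewrite -sum_nrm_norm (_ : sum_nrm _ = b).
    apply: (cvgr_to_le (cvg_norm bP)); apply: filterS Fz => x.
    by rewrite -ball_normE /= sum_nrm_norm distrC => /ltW.
  by apply: abs_fun_inj; apply/funext => i; rewrite bl -(sum_fun_sub (AbsSum lE)).
apply: filterS Fz => x; rewrite -ball_normE /= => zx.
rewrite (_ : _ - x = (AbsSum lE - z) + (z - x)); last by rewrite addrA subrK.
by rewrite (le_lt_trans (ler_normD _ _))// [e]splitr ler_ltD.
Qed.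
HB.instance Definition _ :=
  Uniform_isComplete.Build (abs_sum E X) abs_sum_complete.

End abs_sum_structure.

(* Main.v *)
Require Import Defs.
From HB Require Import structures.
From mathcomp Require Import all_boot all_order all_algebra.
From mathcomp Require Import all_classical all_reals all_analysis.
From mathcomp Require Import lra.

Set Implicit Arguments.
Unset Strict Implicit.
Unset Printing Implicit Defensive.

Import Order.TTheory GRing.Theory Num.Theory.
Import numFieldNormedType.Exports.

Local Open Scope classical_set_scope.
Local Open Scope ring_scope.

(** Why absolute sums inherit the two properties.

    Both properties say that, for u in the sphere with |u + x| close to 2, a
    functional nearly norms u if and only if it nearly norms x; they differ
    only in whether the functional is fixed beforehand. [acs_modulus x Phi] is
    the corresponding epsilon-delta statement for functionals in Phi
    ([acs_modulusP]): sluacs+ takes the whole dual sphere for Phi, luacs+ takes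
    the singletons. One argument with a general Phi settles both.

    Write Nx for the element (|x_i|)_i of E, which is [sum_nrm x], and f_i for
    the restriction of a functional f to the i-th summand. The argument avoids
    describing the dual of the sum: for vectors v_i in the unit balls of the
    X_i, the map a |-> (a_i v_i)_i from E to the sum is a linear contraction, so
    that f pulls back to a functional of norm at most 1 on E ([pullback]). As
    |u + x| <= |Nu + Nx|, the modulus of E at Nx applies to all these pullbacks.
    Writing u_i = |u_i| w_i and x_i = |x_i| y_i with w_i, y_i of norm at most 1:
    - if f nearly norms u, pull back along w: f nearly norms (|x_i| w_i)_i;
    - if f nearly norms x, pull back along y on a finite set of coordinates
      carrying almost all of x and along w elsewhere: f nearly norms the vector
      which is |u_i| y_i on that finite set and u_i elsewhere.
    In both cases w_i and y_i remain to be exchanged on finitely many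
    coordinates with x_i <> 0, at a small cost in the value of f. That is
    [coordinate_transfer]. If the norm of f_i is small, so is the cost.
    Otherwise the modulus of X_i at y_i, for f_i divided by its norm, gives the
    claim, once |u_i| is bounded below and |w_i + y_i| is close to 2.

    These two facts come from a second use of E ([no_spare_coordinate]). If
    c = Nx - t e_i lies in the unit ball and |Nu + c| is still close to 2, then
    the modulus of E at c makes suitable pullbacks nearly norm both Nx and c,
    hence nearly vanish at e_i, which contradicts the lower bound on the norm
    of f_i. Were |u_i + x_i| smaller than |u_i| + |x_i| by at least t, this
    would apply to c = Nx - t e_i; were |u_i| tiny, it would apply to
    c = Nx - 2 |x_i| e_i, where the sign of one coordinate is flipped. *)

(** * Functionals of norm at most one *)

Section Functionals.
Context {R : realType} {X : completeNormedModType R}.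
Implicit Types f : {linear X -> R^o}.

Definition dual_ball f : Prop := forall z, `|f z : R| <= `|z|.

Lemma dual_ball_le f z : dual_ball f -> f z <= `|z|.
Proof. by move=> /(_ z); exact: le_trans (ler_norm _). Qed.

(** [dual_norm] is a supremum, which is the operator norm only when the set
    of values has an upper bound; the lemmas on it therefore assume some
    Lipschitz constant C. *)
Lemma bounded_has_sup f (C : R) : (forall z, `|f z : R| <= C * `|z|) ->
  has_sup [set `|f x| | x in [set x : X | `|x| <= 1]].
Proof.
move=> fC; split; first by exists `|f 0|, 0 => //=; rewrite normr0.
have C1 : C <= `|C| := ler_norm C; have C0 := normr_ge0 C.
exists `|C| => _ [z /= z1 <-]; apply: le_trans (fC z) _.
by have := normr_ge0 z; nra.
Qed.

Lemma le_dual_norm f (C : R) z : (forall z, `|f z : R| <= C * `|z|) ->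
  `|z| <= 1 -> `|f z : R| <= dual_norm f.
Proof.
by move=> /bounded_has_sup[_ fs] z1; apply: ub_le_sup => //; exists z.
Qed.

Lemma dual_norm_lub f (C D : R) : (forall z, `|f z : R| <= C * `|z|) ->
  (forall z, `|z| <= 1 -> `|f z : R| <= D) -> dual_norm f <= D.
Proof.
move=> /bounded_has_sup[f0 _] fD; apply: ge_sup => // _ [z /= z1 <-].
exact: fD.
Qed.

Lemma dual_norm_ge0 f (C : R) : (forall z, `|f z : R| <= C * `|z|) ->
  0 <= dual_norm f.
Proof.
move=> fC; apply: le_trans (le_dual_norm (z := 0) fC _) => //.
by rewrite normr0.
Qed.

Lemma ler_dual_norm f (C : R) z : (forall z, `|f z : R| <= C * `|z|) ->
  `|f z : R| <= dual_norm f * `|z|.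
Proof.
move=> fC; have [->|z0] := eqVneq z 0; first by rewrite linear0 !normr0 mulr0.
have nz : 0 < `|z| by rewrite normr_gt0.
have := @le_dual_norm f C (`|z|^-1 *: z) fC.
rewrite normrZ normfV normr_id mulVf ?gt_eqF//.
rewrite linearZ /= normrM normfV normr_id.
by move=> /(_ (lexx _)); rewrite mulrC ler_pdivrMr.
Qed.

Lemma dual_norm_witness f (C k : R) : (forall z, `|f z : R| <= C * `|z|) ->
  k < dual_norm f -> exists2 v, `|v| <= 1 & k < f v.
Proof.
move=> /bounded_has_sup fs kf.
have [|_ [v /= v1 <-]] := sup_adherent (eps := dual_norm f - k) _ fs.
  by rewrite subr_gt0.
rewrite opprB addrC subrK => kv.
have [fv0|fv0] := leP 0 (f v : R).
  by exists v => //; rewrite ger0_norm in kv.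
by exists (- v); rewrite ?normrN// linearN; rewrite ltr0_norm in kv.
Qed.

Lemma dual_sphere_ball f : dual_sphere f -> dual_ball f.
Proof.
move=> [fc f1] z.
have [C [Creal fC]] :=
  (linear_boundedP f).1 ((linear_bounded_continuous f).2 fc).
have := @ler_dual_norm f (`|C| + 1) z; rewrite f1 mul1r; apply => {}z.
by apply: fC; rewrite (le_lt_trans (ler_norm C))// ltrDl.
Qed.

Lemma dual_ball_bounded f : dual_ball f -> forall z, `|f z : R| <= 1 * `|z|.
Proof. by move=> fc z; rewrite mul1r. Qed.

Definition dual_normalize f : {linear X -> R^o} := (dual_norm f)^-1 \*: f.

Lemma dual_normalize_sphere f : dual_ball f -> 0 < dual_norm f ->
  dual_sphere (dual_normalize f).
Proof.
move=> /dual_ball_bounded fc f0.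
have fn z : `|dual_normalize f z : R| <= 1 * `|z|.
  rewrite mul1r /= normrM normfV (gtr0_norm f0) mulrC.
  rewrite ler_pdivrMr// mulrC.
  exact: ler_dual_norm fc.
split.
  apply/linear_bounded_continuous/linear_boundedP; exists 1; split => // C C1 z.
  by rewrite (le_trans (fn z))// ler_wpM2r// ltW.
apply/eqP; rewrite eq_le; apply/andP; split.
  by apply: (dual_norm_lub fn) => z; apply: le_trans; rewrite -(mul1r `|z|).
rewrite -[leLHS](mulVf (negbT (gt_eqF f0))) ler_pdivrMl//.
apply: (dual_norm_lub fc) => z z1.
rewrite -ler_pdivrMl//.
apply: le_trans (le_dual_norm fn z1).
by rewrite /= normrM normfV (gtr0_norm f0).
Qed.

End Functionals.

(** * Epsilon-delta form of the two properties *)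

Lemma near0_pos_ex (R : realType) (P : R -> Prop) :
  (\forall d \near 0^'+, P d) -> exists2 d, 0 < d & P d.
Proof.
move=> HP; near (0 : R)^'+ => d; exists d; near: d => //.
exact: nbhs_right_gt.
Unshelve. all: by end_near. Qed.

Section Modulus.
Context {R : realType} {X : completeNormedModType R}.
Implicit Types (x : X) (Phi : set {linear X -> R^o}).

(** Only small d matter, so that d ranges near 0: several such statements can
    then be combined without taking minima. *)
Definition acs_modulus x Phi : Prop :=
  forall e : R, 0 < e -> \forall d \near 0^'+, forall u f,
    `|u| = 1 -> Phi f -> 2 - d <= `|u + x| ->
    (1 - d <= f u -> 1 - e <= f x) /\ (1 - d <= f x -> 1 - e <= f u).

Lemma sub_acs_modulus x Phi Psi : Phi `<=` Psi ->
  acs_modulus x Psi -> acs_modulus x Phi.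
Proof.
move=> sub H e /H; apply: filterS => d Hd u f u1 /sub; exact: Hd.
Qed.

(** If the epsilon-delta statement fails for e, choosing a counterexample for
    each d = 1/(n+1) gives a sequence along which k and g converge to their
    largest values while h stays below 1 - e. *)
Lemma near0_cvg_sequence (T : Type) (P : set T) (g h k : T -> R) :
  (forall t, P t -> g t <= 1) -> (forall t, P t -> k t <= 2) ->
  (forall t : nat -> T, (forall n, P (t n)) ->
     k (t n) @[n --> \oo] --> (2 : R) ->
     g (t n) @[n --> \oo] --> (1 : R) -> h (t n) @[n --> \oo] --> (1 : R)) ->
  forall e : R, 0 < e -> \forall d \near 0^'+, forall t, P t ->
    2 - d <= k t -> 1 - d <= g t -> 1 - e <= h t.
Proof.
move=> g1 k2 H e e0; apply: contrapT => nH.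
have /choice[t tP] : forall n, exists t,
    [/\ P t, 2 - n.+1%:R^-1 <= k t, 1 - n.+1%:R^-1 <= g t & h t < 1 - e].
  move=> n; apply: contrapT => nt; apply: nH.
  near=> d => t Pt kt gt; rewrite leNgt; apply/negP => ht.
  have dn : d <= n.+1%:R^-1 by near: d; apply: nbhs_right_le; rewrite invr_gt0.
  apply: nt; exists t; split => //.
    by apply: le_trans kt; rewrite lerD2l lerN2.
  by apply: le_trans gt; rewrite lerD2l lerN2.
have small (s : nat -> R) (l : R) : (forall n, s n <= l) ->
    (forall n, l - n.+1%:R^-1 <= s n) -> s n @[n --> \oo] --> l.
  move=> sl ls; apply/cvgrPdist_lt => d d0.
  have [N _ NP] := near_infty_natSinv_lt (PosNum d0).
  exists N => // n /NP /= dn; rewrite ger0_norm ?subr_ge0//.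
  by rewrite (le_lt_trans _ dn)// lerBlDr -lerBlDl.
have /cvgrPdist_lt/(_ e e0)[N _ /(_ N (leqnn N))] :
    h (t n) @[n --> \oo] --> (1 : R).
  apply: H; first by move=> n; case: (tP n).
    by apply: small => n; case: (tP n) => // + _ _ _; exact: k2.
  by apply: small => n; case: (tP n) => // + _ _ _; exact: g1.
rewrite /=; have [_ _ _ hN] := tP N.
by rewrite ger0_norm; lra.
Unshelve. all: by end_near. Qed.

Lemma cvg_sequence_near0 (T : Type) (P : set T) (g h k : T -> R) :
  (forall t, P t -> h t <= 1) ->
  (forall e : R, 0 < e -> \forall d \near 0^'+, forall t, P t ->
    2 - d <= k t -> 1 - d <= g t -> 1 - e <= h t) ->
  forall t : nat -> T, (forall n, P (t n)) ->
     k (t n) @[n --> \oo] --> (2 : R) ->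
     g (t n) @[n --> \oo] --> (1 : R) -> h (t n) @[n --> \oo] --> (1 : R).
Proof.
move=> h1 H t tP kt gt; apply/cvgrPdist_le => e e0.
have [d d0 Hd] := near0_pos_ex (H e e0).
move/cvgrPdist_le : kt => /(_ _ d0); move/cvgrPdist_le : gt => /(_ _ d0).
apply: filterS2 => n /ler_normlP[_ gn] /ler_normlP[_ kn].
have := h1 _ (tP n); rewrite ler_norml => hn.
have := Hd _ (tP n); move=> /(_ ltac:(lra) ltac:(lra)) => hd.
by apply/andP; split; lra.
Unshelve. all: by end_near. Qed.

(** The two implications are instances of the same passage from sequences to
    epsilon-delta, on pairs (u, f), with the evaluations at u and at x in
    exchanged roles. *)
Lemma acs_modulusP x Phi : `|x| = 1 -> Phi `<=` @dual_sphere R X ->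
  acs_modulus x Phi <->
  forall (u : nat -> X) (f : nat -> {linear X -> R^o}),
    (forall n, unit_sphere (u n)) -> (forall n, Phi (f n)) ->
    `|u n + x| @[n --> \oo] --> (2 : R) ->
    (f n (u n) @[n --> \oo] --> (1 : R)) <-> (f n x @[n --> \oo] --> (1 : R)).
Proof.
move=> x1 Phi1.
pose P : set (X * {linear X -> R^o}) := [set t | `|t.1| = 1 /\ Phi t.2].
pose k (t : X * {linear X -> R^o}) : R := `|t.1 + x|.
pose g (t : X * {linear X -> R^o}) : R := t.2 t.1.
pose h (t : X * {linear X -> R^o}) : R := t.2 x.
have k2 t : P t -> k t <= 2.
  by move=> [t1 _]; rewrite (le_trans (ler_normD _ _))// t1 x1; lra.
have g1 t : P t -> g t <= 1.
  by move=> [t1 /Phi1/dual_sphere_ball/dual_ball_le]; rewrite -t1; apply.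
have h1 t : P t -> h t <= 1.
  by move=> [t1 /Phi1/dual_sphere_ball/dual_ball_le]; rewrite -x1; apply.
split => [H u f u1 fP ux|H e e0].
  have tP n : P (u n, f n) by split; [exact: u1|exact: fP].
  split.
    apply: (cvg_sequence_near0 (k := k) (g := g) h1 _ tP ux) => e /H.
    by apply: filterS => d Hd [v p] [v1 Pp] kd; have [] := Hd v p v1 Pp kd.
  apply: (cvg_sequence_near0 (k := k) (g := h) g1 _ tP ux) => e /H.
  by apply: filterS => d Hd [v p] [v1 Pp] kd; have [] := Hd v p v1 Pp kd.
near=> d => u f u1 fP ux; split.
  move: (conj u1 fP) ux; rewrite -[_ /\ _]/(P (u, f)).
  rewrite -/(k (u, f)) -/(g (u, f)) -/(h (u, f)).
  move: (u, f); near: d; apply: (near0_cvg_sequence g1 k2) => // t tP kt.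
  by rewrite (propext (H (fst \o t) (snd \o t) _ _ kt)) // => n; case: (tP n).
move: (conj u1 fP) ux; rewrite -[_ /\ _]/(P (u, f)).
rewrite -/(k (u, f)) -/(g (u, f)) -/(h (u, f)).
move: (u, f); near: d; apply: (near0_cvg_sequence h1 k2) => // t tP kt.
by rewrite -(propext (H (fst \o t) (snd \o t) _ _ kt)) // => n; case: (tP n).
Unshelve. all: by end_near. Qed.

Lemma sluacs_plusP :
  sluacs_plus X <-> forall x, `|x| = 1 -> acs_modulus x (@dual_sphere R X).
Proof.
split=> [H x x1|H x u x1 u1 ux f f1].
  by apply/acs_modulusP => // u f u1 f1 ux; exact: H.
by apply: (acs_modulusP x1 (@subset_refl _ _)).1 => //; exact: H.
Qed.

(** With Phi a singleton, the sequences of functionals are constant, and a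
    constant sequence converges to 1 exactly when its value is 1. *)
Lemma luacs_plusP : luacs_plus X <->
  forall x f, `|x| = 1 -> dual_sphere f -> acs_modulus x [set f].
Proof.
have cst (a : R) : (a @[_ --> \oo] --> (1 : R)) <-> a = 1.
  by split=> [/(cvg_unique _ (cvg_cst a))->//|->]; exact: cvg_cst.
split=> [H x f x1 f1|H x u x1 u1 ux f f1].
  apply/acs_modulusP => // [_ -> //|u g u1 gf ux].
  have {g gf}-> : g = fun=> f by apply/funext.
  by rewrite (propext (cst _)); exact: H.
rewrite -(propext (cst _)).
by apply: ((acs_modulusP x1 _).1 (H x f x1 f1) u (fun=> f)) => // _ ->.
Qed.

(** Pullbacks of functionals to E may have norm less than 1, and so may the
    vectors |x| - t e_i of E, hence this extension to the unit balls. If x has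
    norm less than 1, then |u + x| cannot approach 2. A functional f of
    norm at most 1 which nearly norms a unit vector has norm at least 1 - d, so
    normalising it changes its values on the sphere by at most d. *)
Lemma sluacs_plus_ball : sluacs_plus X ->
  forall x, `|x| <= 1 -> acs_modulus x dual_ball.
Proof.
move=> /sluacs_plusP Xs x.
rewrite le_eqVlt => /predU1P[x1 e e0|x1 e e0]; last first.
  near=> d => u f u1 fc; rewrite leNgt => /negP[].
  rewrite (le_lt_trans (ler_normD _ _))// u1.
  suff : d < 1 - `|x| by lra.
  by near: d; apply: nbhs_right_lt; rewrite subr_gt0.
near=> d => u f u1 fc ux.
have d2 : d < 1 by near: d; exact: nbhs_right_lt.
have de : d <= e / 2 by near: d; apply: nbhs_right_le; rewrite divr_gt0.
have d0 : 0 < d by near: d; exact: nbhs_right_gt.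
set l := dual_norm f.
have fl z : `|z| = 1 -> f z <= l.
  move=> z1; apply: le_trans (ler_norm _) _.
  by apply: le_dual_norm (dual_ball_bounded fc) _; rewrite z1.
have l1 : l <= 1.
  by apply: (dual_norm_lub (dual_ball_bounded fc)) => z; apply: le_trans.
suff H z w : `|z| = 1 -> `|w| = 1 -> 1 - d <= f z ->
    (dual_sphere (dual_normalize f) -> 1 - d <= dual_normalize f z ->
     1 - e / 2 <= dual_normalize f w) -> 1 - e <= f w.
  have Hd : forall u f, `|u| = 1 -> dual_sphere f -> 2 - d <= `|u + x| ->
    (1 - d <= f u -> 1 - e / 2 <= f x) /\ (1 - d <= f x -> 1 - e / 2 <= f u).
    by near: d; apply: Xs; rewrite // divr_gt0.
  by split=> fz; apply: (H _ _ _ _ fz) => // fs; case: (Hd _ _ u1 fs ux).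
move=> z1 w1 fz.
have l0 : 0 < l by have := fl _ z1; lra.
move=> /(_ (dual_normalize_sphere fc l0)) Hz.
have {Hz} : 1 - e / 2 <= l^-1 * (f w : R).
  apply: Hz; rewrite -[leRHS]/(l^-1 * f z) mulrC ler_pdivlMr//.
  by have := fl _ z1; nra.
rewrite ler_pdivlMl// => fw.
have := fl _ z1.
have [|] := leP 0 (1 - e/2); nra.
Unshelve. all: by end_near. Qed.

End Modulus.

(** * Normalising two vectors *)

(** Near equality in the triangle inequality survives normalisation: if
    |q| <= |p|, then |q| (p/|p| + q/|q|) differs from p + q by a multiple of p
    of norm |p| - |q|. *)
Lemma ler_norm_normalised (R : realType) (V : normedModType R) (p q : V)
    (m t : R) : 0 < m -> m <= `|p| -> m <= `|q| ->
  `|p| + `|q| - t <= `|p + q| ->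
  2 - t / m <= `| `|p|^-1 *: p + `|q|^-1 *: q|.
Proof.
move=> m0; wlog qp : p q / `|q| <= `|p|.
  move=> H mp mq pq; have [qp|/ltW qp] := leP `|q| `|p|; first exact: H.
  by rewrite [X in `|X|]addrC; apply: H; rewrite // (addrC `|q|) (addrC q).
move=> mp mq pq; have p0 := lt_le_trans m0 mp; have q0 := lt_le_trans m0 mq.
have t0 : 0 <= t by have := ler_normD p q; lra.
set r := `|p|^-1 *: p + _.
have rE : `|q| *: r = (p + q) - (1 - `|q| / `|p|) *: p.
  rewrite scalerDr !scalerA divff ?gt_eqF// scale1r scalerBl scale1r.
  by rewrite opprB [in RHS]addrC addrA subrK.
have nr : `|p + q| - (`|p| - `|q|) <= `|q| * `|r|.
  rewrite -[X in X * _]normr_id -normrZ rE.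
  rewrite (le_trans _ (lerB_dist _ _))// lerD2l lerN2.
  rewrite normrZ ger0_norm ?subr_ge0 ?ler_pdivrMr ?mul1r//.
  by rewrite mulrBl mul1r divfK ?gt_eqF.
have : 2 - t / `|q| <= `|r|.
  rewrite -(ler_pM2l q0) mulrBr mulrCA divff ?gt_eqF// mulr1; lra.
apply: le_trans; rewrite lerD2l lerN2 ler_wpM2l// lef_pV2//.
Qed.

(** * Functionals on an absolute sum *)

Section AbsoluteSum.
Context {R : realType} {I : Type} {E : abs_normed R I}.
Context {X : I -> completeNormedModType R}.
Implicit Types (a b c : abs_space E) (x y z u : abs_sum E X).
Implicit Types (i j : I) (v w : forall j, X j) (s : seq I).
Implicit Types f : {linear abs_sum E X -> R^o}.

Lemma abs_norm_mono a b : (forall j, `|a j| <= `|b j|) -> `|a| <= `|b|.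
Proof. by move=> /abs_solid[]. Qed.

Lemma sum_norm_mono x y : (forall j, `|x j| <= `|y j|) -> `|x| <= `|y|.
Proof.
move=> xy; rewrite -!sum_nrm_norm; apply: abs_norm_mono => j.
by rewrite /= !normr_id.
Qed.

Lemma abs_unit_diag i : abs_unit E i i = 1.
Proof. by rewrite /= indicE mem_set. Qed.

Lemma abs_unit_off i j : i <> j -> abs_unit E i j = 0.
Proof. by move=> ij; rewrite /= indicE memNset// => ji; exact: ij. Qed.

(** The index type has no decidable equality and the summands depend on the
    index, so replacing a coordinate takes a classical test and a transport. *)
Definition update w i (p : X i) j : X j :=
  if pselect (i = j) is left ij then eq_rect i (fun j => X j : Type) p j ij
  else w j.

Lemma update_diag w i (p : X i) : update w p i = p.
Proof.
by rewrite /update; case: pselect => // ii; rewrite (Prop_irrelevance ii erefl).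
Qed.

Lemma update_off w i (p : X i) j : i <> j -> update w p j = w j.
Proof. by rewrite /update; case: pselect. Qed.

Lemma sum_injP i (p : X i) : carrier E (fun j => `|update (fun=> 0) p j|).
Proof.
apply: proj1 (abs_solid (b := `|p| *: abs_unit E i) _) => j.
rewrite abs_fun_scale normr_id [leRHS]normrM normr_id.
have [<-|ij] := pselect (i = j).
  by rewrite update_diag abs_unit_diag normr1 mulr1.
by rewrite update_off// normr0 mulr_ge0.
Qed.

Definition sum_inj i (p : X i) : abs_sum E X := AbsSum (sum_injP p).

Lemma sum_inj_diag i (p : X i) : sum_inj p i = p.
Proof. exact: update_diag. Qed.

Lemma sum_inj_off i (p : X i) j : i <> j -> sum_inj p j = 0.
Proof. exact: update_off. Qed.

Lemma sum_inj_is_linear i : linear (@sum_inj i).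
Proof.
move=> k p q; apply: sum_fun_ext => j; rewrite sum_fun_add sum_fun_scale.
have [<-|ij] := pselect (i = j); first by rewrite !sum_inj_diag.
by rewrite !sum_inj_off// scaler0 addr0.
Qed.

HB.instance Definition _ i :=
  GRing.isLinear.Build R (X i) (abs_sum E X) *:%R (@sum_inj i)
    (@sum_inj_is_linear i).

Lemma norm_sum_inj i (p : X i) : `|sum_inj p| = `|p|.
Proof.
have := sum_coord_le (sum_inj p) i; rewrite sum_inj_diag => pl.
apply/eqP; rewrite eq_le pl andbT.
rewrite -[leRHS]normr_id -[leRHS]mulr1 -(norm_fun_normalised E i).
rewrite -[_ * _](abs_normZ `|p| (abs_unit E i)) -sum_nrm_norm.
apply: abs_norm_mono => j; rewrite abs_fun_scale [leRHS]normrM !normr_id.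
have [<-|ij] := pselect (i = j).
  by rewrite abs_unit_diag normr1 mulr1 sum_inj_diag.
by rewrite sum_inj_off// normr0 mulr_ge0.
Qed.

Definition component f i : {linear X i -> R^o} := f \o @sum_inj i.

Lemma componentE f i p : component f i p = f (sum_inj p).
Proof. by []. Qed.

Lemma component_dual_ball f i : dual_ball f -> dual_ball (component f i).
Proof. by move=> fc p; rewrite componentE -(norm_sum_inj p). Qed.

Lemma radialP v (v1 : forall j, `|v j| <= 1) a :
  carrier E (fun j => `|a j *: v j|).
Proof.
apply: proj1 (abs_solid (b := a) _) => j.
by rewrite normr_id normrZ ler_piMr// v1.
Qed.

(** A choice of vectors of the unit balls embeds E into the sum as a
    contraction. *)
Definition radial v (v1 : forall j, `|v j| <= 1) a : abs_sum E X :=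
  AbsSum (radialP v1 a).

Lemma radial_is_linear v (v1 : forall j, `|v j| <= 1) : linear (radial v1).
Proof.
by move=> k a b; apply: sum_fun_ext => j; rewrite /= scalerDl scalerA.
Qed.

HB.instance Definition _ v (v1 : forall j, `|v j| <= 1) :=
  GRing.isLinear.Build R (abs_space E) (abs_sum E X) *:%R (radial v1)
    (radial_is_linear v1).

Lemma norm_radial v (v1 : forall j, `|v j| <= 1) a : `|radial v1 a| <= `|a|.
Proof.
rewrite -sum_nrm_norm; apply: abs_norm_mono => j.
by rewrite normr_id normrZ ler_piMr// v1.
Qed.

Definition pullback f v (v1 : forall j, `|v j| <= 1) :
  {linear abs_space E -> R^o} := f \o radial v1.

Lemma pullback_dual_ball f v (v1 : forall j, `|v j| <= 1) :
  dual_ball f -> dual_ball (pullback f v1).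
Proof. by move=> fc a; exact: le_trans (fc _) (norm_radial _ _). Qed.

Lemma pullback_unit f v (v1 : forall j, `|v j| <= 1) i :
  pullback f v1 (abs_unit E i) = component f i (v i).
Proof.
congr (f _); apply: sum_fun_ext => j /=.
have [<-|ij] := pselect (i = j).
  by rewrite -[\1_ _ i]/(abs_unit E i i) abs_unit_diag scale1r update_diag.
by rewrite -[\1_ _ j]/(abs_unit E i j) abs_unit_off// scale0r update_off.
Qed.

(** Where [x j = 0] this is 0, which keeps [directionK] valid everywhere. *)
Definition direction x j : X j := `|x j|^-1 *: x j.

Lemma norm_direction x j : x j != 0 -> `|direction x j| = 1.
Proof. by move=> x0; rewrite normrZ normfV normr_id mulVf ?normr_eq0. Qed.

Lemma norm_direction_le1 x j : `|direction x j| <= 1.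
Proof.
have [x0|/norm_direction->//] := eqVneq (x j) 0.
by rewrite /direction x0 scaler0 normr0.
Qed.

Lemma directionK x j : `|x j| *: direction x j = x j.
Proof.
have [x0|x0] := eqVneq (x j) 0; first by rewrite /direction x0 normr0 scale0r.
by rewrite scalerA divff ?normr_eq0// scale1r.
Qed.

(** Pulling back along the directions of z gives the value [f z] at |z|.
    Replacing the i-th direction by a vector nearly norming the i-th component
    only increases that value, and makes the pullback large at [abs_unit i]. *)
Lemma exists_better_pullback f z i (k : R) : dual_ball f ->
  k < dual_norm (component f i) ->
  exists v, exists v1 : forall j, `|v j| <= 1,
    f z <= pullback f v1 (sum_nrm z) /\ k < component f i (v i).
Proof.
move=> fc kf.
have [kz|kz] := ltP k (component f i (direction z i)).
  exists (direction z), (norm_direction_le1 z); split => //.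
  rewrite le_eqVlt; apply/orP; left; apply/eqP; congr (f _).
  by apply: sum_fun_ext => j; rewrite /= directionK.
have [p p1 kp] :=
  dual_norm_witness (dual_ball_bounded (component_dual_ball (i := i) fc)) kf.
pose v := update (direction z) p.
have v1 j : `|v j| <= 1.
  rewrite /v; have [<-|ij] := pselect (i = j); first by rewrite update_diag.
  by rewrite update_off// norm_direction_le1.
exists v, v1; split; last by rewrite /v update_diag.
have vE : radial v1 (sum_nrm z) = z + `|z i| *: sum_inj (p - direction z i).
  apply: sum_fun_ext => j; rewrite sum_fun_add sum_fun_scale /= /v.
  have [<-|ij] := pselect (i = j).
    by rewrite !update_diag scalerBr directionK addrC subrK.
  by rewrite !update_off// scaler0 addr0 directionK.
have -> : pullback f v1 (sum_nrm z) =
    f z + `|z i| * component f i (p - direction z i) :> R.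
  by rewrite -[LHS]/(f (radial v1 (sum_nrm z))) vE linearD linearZ.
by rewrite lerDl mulr_ge0// linearB subr_ge0 (le_trans kz)// ltW.
Qed.

(** Otherwise f would exceed 1 on the vector obtained from z by rotating its
    i-th coordinate, with unchanged norm, towards a vector that nearly norms
    the component. *)
Lemma component_norming f z i (d : R) : dual_ball f -> `|z| = 1 ->
  1 - d <= f z -> dual_norm (component f i) * `|z i| - d <= component f i (z i).
Proof.
move=> fc z1 fz.
have d0 : 0 <= d by have := dual_ball_le z fc; lra.
have [->|zi0] := eqVneq (z i) 0.
  by rewrite normr0 mulr0 linear0; lra.
have nz : 0 < `|z i| by rewrite normr_gt0.
have H p : `|p| <= 1 -> `|z i| * component f i p - d <= component f i (z i).
  move=> p1.
  have := dual_ball_le (z + sum_inj (`|z i| *: p - z i)) fc.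
  have : `|z + sum_inj (`|z i| *: p - z i)| <= `|z|.
    apply: sum_norm_mono => j; rewrite sum_fun_add.
    have [<-|ij] := pselect (i = j).
      by rewrite sum_inj_diag addrC subrK normrZ normr_id ler_piMr.
    by rewrite sum_inj_off// addr0.
  rewrite z1 => nle /le_trans/(_ nle).
  have -> : f (z + sum_inj (`|z i| *: p - z i)) =
      f z + (`|z i| * component f i p - component f i (z i)) :> R.
    by rewrite linearD -[X in _ + X]/(component f i _) linearB linearZ.
  by lra.
rewrite lerBlDr -ler_pdivlMr//.
have fib := dual_ball_bounded (component_dual_ball (i := i) fc).
apply: (dual_norm_lub fib) => p p1.
rewrite ler_pdivlMr// mulrC.
have Hp := H p p1; have := H (- p); rewrite normrN linearN mulrN => /(_ p1) Hn.
by case: (ger0P (component f i p)) => _; [|rewrite mulrN]; lra.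
Qed.

(** Exchanging the coordinates in s one at a time costs at most e each; a
    repeated index is harmless, its second exchange being zero. *)
Lemma functional_ge_coordinates f z y s (e : R) : 0 <= e ->
  (forall j, ~ List.In j s -> z j = y j) ->
  (forall j, List.In j s -> - e <= component f j (z j - y j)) ->
  f y - (size s)%:R * e <= f z.
Proof.
move=> e0; elim: s y => [|i s IH] y.
  move=> zy _; rewrite mul0r subr0 le_eqVlt; apply/orP; left; apply/eqP.
  by congr (f _); apply: sum_fun_ext => j; rewrite zy.
move=> zy fzy.
pose y' := y + sum_inj (z i - y i).
have y'i : y' i = z i by rewrite sum_fun_add sum_inj_diag addrC subrK.
have y'j j : i <> j -> y' j = y j.
  by move=> ij; rewrite sum_fun_add sum_inj_off// addr0.
have := IH y'.
have -> : f y' = f y + component f i (z i - y i) :> R by rewrite linearD.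
have := fzy i (or_introl erefl).
rewrite -[size (i :: s)]addn1 natrD => fi.
have H1 : forall j : I, ~ List.In j s -> z j = y' j.
  move=> j js; have [<-//|ij] := pselect (i = j).
  by rewrite y'j// zy// => -[].
have H2 : forall j : I, List.In j s -> - e <= component f j (z j - y' j).
  move=> j js; have [<-|ij] := pselect (i = j).
    by rewrite y'i subrr linear0 oppr_le0.
  by rewrite y'j// fzy//; right.
by move=> /(_ H1 H2); lra.
Qed.

Lemma unit_span_support (a : abs_space E) : unit_span E a ->
  exists s, forall j, ~ List.In j s -> a j = 0.
Proof.
move=> [s [k ->]]; exists s => j; elim: s => [|i s IH] ij.
  by rewrite big_nil.
rewrite big_cons abs_fun_add.
rewrite -[LHS]/((k i *: abs_unit E i : abs_space E) j +
  (\sum_(i <- s) k i *: abs_unit E i : abs_space E) j) IH ?addr0.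
  rewrite -[LHS]/(k i * abs_unit E i j) abs_unit_off ?mulr0// => ji.
  by apply: ij; left.
by move=> js; apply: ij; right.
Qed.

(** Density of the span gives a finitely supported b close to [sum_nrm x], and
    outside the support of b the coordinates of x are those of the
    difference. *)
Lemma finite_concentration x (e : R) : dense (unit_span E) -> 0 < e ->
  exists s, forall y, (forall j, List.In j s -> y j = 0) ->
    (forall j, `|y j| <= `|x j|) -> `|y| <= e.
Proof.
move=> dE e0.
have [b [/= bx /unit_span_support[s bs]]] :
    ball (sum_nrm x) e `&` unit_span E !=set0.
  apply: dE; last exact: ball_open.
  by exists (sum_nrm x); exact: ballxx.
exists s => y ys yx; move: bx; rewrite -ball_normE /= => /ltW; apply: le_trans.
rewrite -sum_nrm_norm; apply: abs_norm_mono => j.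
rewrite abs_fun_sub -[X in _ <= `|X|]/(`|x j| - b j) /= normr_id.
have [js|js] := pselect (List.In j s); first by rewrite ys// normr0.
by rewrite bs// subr0 normr_id.
Qed.

End AbsoluteSum.

(** * Exchanging directions in one coordinate *)

Section CoordinateTransfer.
Context {R : realType} {I : Type} {E : abs_normed R I}.
Context (X : I -> completeNormedModType R).
Context (E_sluacs : sluacs_plus (abs_space E)).
Implicit Types (a b c : abs_space E) (u z : abs_sum E X).
Implicit Types (f : {linear abs_sum E X -> R^o}).

Context (x : abs_sum E X) (x1 : `|x| = 1).

Lemma norm_add_le u : `|u + x| <= `|sum_nrm u + sum_nrm x|.
Proof. exact: (abs_solid (sum_add_le u x)).2. Qed.

(** The subtracted amount t may exceed the i-th coordinate: t = 2 |x_i|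
    flips its sign. *)
Definition lowered i (t : R) : abs_space E := sum_nrm x - t *: abs_unit E i.

Lemma lowered_diag i t : lowered i t i = `|x i| - t.
Proof.
rewrite abs_fun_sub -[LHS]/(`|x i| - t * abs_unit E i i).
by rewrite abs_unit_diag mulr1.
Qed.

Lemma lowered_off i t j : i <> j -> lowered i t j = `|x j|.
Proof.
move=> ij; rewrite abs_fun_sub -[LHS]/(`|x j| - t * abs_unit E i j).
by rewrite abs_unit_off// mulr0 subr0.
Qed.

Lemma norm_lowered i t : 0 <= t -> t <= 2 * `|x i| -> `|lowered i t| <= 1.
Proof.
move=> t0 t2; rewrite -x1 -sum_nrm_norm; apply: abs_norm_mono => j.
rewrite -[X in _ <= `|X|]/(`|x j|) normr_id.
have [<-|ij] := pselect (i = j); last by rewrite lowered_off ?normr_id.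
by rewrite lowered_diag ler_norml; apply/andP; split; lra.
Qed.

(** If |sum_nrm u + lowered i t| were close to 2, the modulus of E at
    [lowered i t] would make a pullback g that nearly norms [sum_nrm u] also
    nearly norm [lowered i t]. As g is at most 1 at [sum_nrm x], this leaves at
    most t k / 4 for t g(e_i), whereas g can be chosen with g(e_i) > k / 2. If
    f nearly norms x instead of u, g first nearly norms [sum_nrm x], and the
    modulus of E there shows that it nearly norms [sum_nrm u] as well. *)
Lemma no_spare_coordinate i (k t : R) : 0 < k -> 0 < t -> t <= 2 * `|x i| ->
  \forall d \near 0^'+, forall u f, `|u| = 1 -> dual_ball f ->
    2 - d <= `|u + x| -> k <= dual_norm (component f i) ->
    1 - d <= f u \/ 1 - d <= f x -> `|sum_nrm u + lowered i t| < 2 - d.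
Proof.
move=> k0 t0 t2; set c := lowered i t.
have c1 : `|c| <= 1 by rewrite norm_lowered// ltW.
have tk : 0 < t * k / 4 by rewrite divr_gt0// mulr_gt0.
have Ec := sluacs_plus_ball E_sluacs c1.
have [d1 d10 Hc] := near0_pos_ex (Ec _ tk).
near=> d => u f u1 fb ux kf fux; rewrite ltNge; apply/negP => uc.
have dd1 : d <= d1 by near: d; exact: nbhs_right_le.
have Ha : forall b g, `|b| = 1 -> dual_ball g -> 2 - d <= `|b + sum_nrm x| ->
    (1 - d <= g b -> 1 - d1 <= g (sum_nrm x)) /\
    (1 - d <= g (sum_nrm x) -> 1 - d1 <= g b).
  by near: d; apply: sluacs_plus_ball => //; rewrite sum_nrm_norm x1.
have [v [v1 [gk gb]]] : exists v, exists v1 : forall j, `|v j| <= 1,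
    k / 2 < component f i (v i) /\ 1 - d1 <= pullback f v1 (sum_nrm u).
  have k2 : k / 2 < dual_norm (component f i) by lra.
  have au1 : `|sum_nrm u| = 1 by rewrite sum_nrm_norm.
  have aux : 2 - d <= `|sum_nrm u + sum_nrm x|.
    exact: le_trans ux (norm_add_le u).
  case: fux => [fu|fx].
    have [v [v1 [fv kv]]] := exists_better_pullback u fb k2.
    by exists v, v1; split => //; apply: le_trans fv; lra.
  have [v [v1 [fv kv]]] := exists_better_pullback x fb k2.
  exists v, v1; split => //.
  apply: (Ha _ _ au1 (pullback_dual_ball v1 fb) aux).2.
  exact: le_trans fv.
have gB := pullback_dual_ball v1 fb.
have gc : 1 - t * k / 4 <= pullback f v1 c.
  by apply: (Hc (sum_nrm u) _ _ gB _).1 => //; apply: le_trans uc; lra.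
have gx := dual_ball_le (sum_nrm x) gB.
move: gc; have -> : pullback f v1 c =
    pullback f v1 (sum_nrm x) - t * component f i (v i) :> R.
  by rewrite /c /lowered linearB linearZ -pullback_unit.
move: gx; rewrite sum_nrm_norm x1.
by nra.
Unshelve. all: by end_near. Qed.

(** A defect of t in the triangle inequality at the coordinate i leaves room to
    lower |x_i|: |u + x| <= |sum_nrm u + lowered i t|. *)
Lemma no_coordinate_defect i (k t : R) : x i != 0 -> 0 < k -> 0 < t ->
  \forall d \near 0^'+, forall u f, `|u| = 1 -> dual_ball f ->
    2 - d <= `|u + x| -> k <= dual_norm (component f i) ->
    1 - d <= f u \/ 1 - d <= f x -> `|u i| + `|x i| - t <= `|u i + x i|.
Proof.
move=> xi k0 t0; have nx : 0 < `|x i| by rewrite normr_gt0.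
(* Lowering by more than |x_i| would change the sign of the coordinate. *)
pose s := Num.min t `|x i|.
have s0 : 0 < s by rewrite lt_min t0.
have [st sx] : s <= t /\ s <= `|x i| by rewrite !ge_min !lexx orbT.
have s2 : s <= 2 * `|x i| by lra.
apply: filterS (no_spare_coordinate k0 s0 s2) => d Hd u f u1 fb ux kf fux.
rewrite leNgt; apply/negP => ht.
have := Hd u f u1 fb ux kf fux; rewrite ltNge => /negP; apply.
apply: le_trans ux _; rewrite -sum_nrm_norm; apply: abs_norm_mono => j.
rewrite -[X in _ <= `|X|]/(`|u j| + lowered i s j).
rewrite -[X in `|X| <= _]/(`|u j + x j|) normr_id.
have [<-|ij] := pselect (i = j); last first.
  by rewrite lowered_off// [leRHS]ger0_norm ?addr_ge0//; exact: ler_normD.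
rewrite lowered_diag; have ui0 := normr_ge0 (u i).
by rewrite [leRHS]ger0_norm; lra.
Qed.

(** If |u_i| is tiny, flipping the sign of the i-th coordinate of [sum_nrm x]
    changes the norm of [sum_nrm u + sum_nrm x] by at most 2 |u_i|. *)
Lemma coordinate_bounded_below i (k : R) : x i != 0 -> 0 < k ->
  exists2 m : R, 0 < m & \forall d \near 0^'+, forall u f, `|u| = 1 ->
    dual_ball f -> 2 - d <= `|u + x| -> k <= dual_norm (component f i) ->
    1 - d <= f u \/ 1 - d <= f x -> m <= `|u i|.
Proof.
move=> xi k0; have nx : 0 < `|x i| by rewrite normr_gt0.
have t0 : 0 < 2 * `|x i| by rewrite mulr_gt0.
have [d1 d10 Hd] := near0_pos_ex (no_spare_coordinate k0 t0 (lexx _)).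
pose c := lowered i (2 * `|x i|).
exists (d1 / 4); first by rewrite divr_gt0.
near=> d => u f u1 fb ux kf fux; rewrite leNgt; apply/negP => um.
have dd1 : d <= d1 / 2 by near: d; apply: nbhs_right_le; rewrite divr_gt0.
have fux1 : 1 - d1 <= f u \/ 1 - d1 <= f x.
  by case: fux => H; [left|right]; apply: le_trans H; lra.
have := Hd u f u1 fb ltac:(lra) kf fux1; rewrite ltNge => /negP; apply.
have H : `|sum_nrm u + sum_nrm x| <=
    `|(2 * `|u i|) *: abs_unit E i - (sum_nrm u + c)|.
  apply: abs_norm_mono => j; rewrite abs_fun_sub.
  rewrite -[X in `|X| <= _]/(`|u j| + `|x j|).
  rewrite -[X in _ <= `|X|]/(2 * `|u i| * abs_unit E i j - (`|u j| + c j)).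
  have [<-|ij] := pselect (i = j).
    rewrite abs_unit_diag lowered_diag le_eqVlt; apply/orP; left; apply/eqP.
    by congr (`|_|); lra.
  by rewrite abs_unit_off// lowered_off// mulr0 sub0r normrN.
have := ler_normB ((2 * `|u i|) *: abs_unit E i) (sum_nrm u + c).
rewrite normrZ [`|abs_unit _ _|]norm_fun_normalised mulr1 normrM normr_id.
rewrite ger0_norm//.
have := norm_add_le u.
by lra.
Unshelve. all: by end_near. Qed.

(** A component of norm below e / 2 moves by less than e on vectors of norm 2.
    A larger one is normalised to h: the coordinates of u and x at i are bounded
    below and nearly additive in norm, so their directions are nearly additive
    too. By [component_norming], h nearly norms the direction of u (of x) if f
    nearly norms u (x), and the modulus of the summand passes this on to the
    other direction. *)
Lemma coordinate_transfer i (Phi : set {linear abs_sum E X -> R^o}) (e : R) :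
  Phi `<=` dual_ball -> x i != 0 ->
  acs_modulus (direction x i)
    [set dual_normalize (component f i) | f in
      Phi `&` [set f | 0 < dual_norm (component f i)]] ->
  0 < e -> \forall d \near 0^'+, forall u f, `|u| = 1 -> Phi f ->
    2 - d <= `|u + x| ->
    (1 - d <= f u -> - e <= component f i (x i - `|x i| *: direction u i)) /\
    (1 - d <= f x -> - e <= component f i (u i - `|u i| *: direction x i)).
Proof.
move=> Phi1 xi Xi e0; have nx : 0 < `|x i| by rewrite normr_gt0.
have e2 : 0 < e / 2 by rewrite divr_gt0.
have [m0 m00 Hm0] := coordinate_bounded_below xi e2.
pose m := Num.min m0 `|x i|.
have m_gt0 : 0 < m by rewrite lt_min m00.
have [mm0 mx] : m <= m0 /\ m <= `|x i| by rewrite !ge_min !lexx orbT.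
have [d1 d10 Hi] := near0_pos_ex (Xi e e0).
(* Normalising divides the defect by m, and the error in the norming of the
   component by its norm, at least e / 2, times a coordinate, at least m. *)
have md0 : 0 < m * d1 by rewrite mulr_gt0.
have dsmall : \forall d \near (0 : R)^'+, d <= d1 * (e / 2 * m).
  by apply: nbhs_right_le; rewrite !mulr_gt0.
apply: filterS3 Hm0 (no_coordinate_defect xi e2 md0) dsmall.
move=> d Hm0 Hdef dm u f u1 Phif ux; have fb := Phi1 _ Phif.
have fib : dual_ball (component f i) by exact: component_dual_ball.
set l := dual_norm (component f i).
have l0 : 0 <= l by exact: dual_norm_ge0 (dual_ball_bounded fib).
have fl p : `|component f i p : R| <= l * `|p|.
  exact: ler_dual_norm (dual_ball_bounded fib).
have l1 : l <= 1.
  by apply: (dual_norm_lub (dual_ball_bounded fib)) => p; apply: le_trans.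
have ui1 : `|u i| <= 1 by rewrite -u1 sum_coord_le.
have xi1 : `|x i| <= 1 by rewrite -x1 sum_coord_le.
have [le2|le2] := ltP l (e / 2).
  have small (p q : X i) : `|p| <= 1 -> `|q| <= 1 ->
      - e <= component f i (p - `|p| *: q).
    move=> p1 q1; have /ler_normlP[+ _] := fl (p - `|p| *: q).
    have : `|p - `|p| *: q| <= 2.
      rewrite (le_trans (ler_normB _ _))// normrZ normr_id.
      by have := normr_ge0 p; have := normr_ge0 q; nra.
    by have := normr_ge0 (p - `|p| *: q); nra.
  by split=> _; apply: small; rewrite // norm_direction_le1.
have lgt0 : 0 < l by lra.
have gap z (q : X i) : `|z i| <= 1 -> `|q| <= 1 ->
    1 - e <= l^-1 * component f i (direction z i) ->
    - e <= component f i (z i - `|z i| *: q).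
  move=> zi1 q1; rewrite ler_pdivlMl// => fz.
  have -> : component f i (z i - `|z i| *: q) =
      `|z i| * (component f i (direction z i) - component f i q) :> R.
    rewrite mulrBr -{1}(directionK z i) linearB.
    by congr (_ - _); exact: linearZ.
  have fq : component f i q <= l.
    by apply: le_trans (ler_norm _) (le_trans (fl q) _); rewrite ler_piMr.
  have : - e <= component f i (direction z i) - component f i q by nra.
  by have := normr_ge0 (z i); nra.
suff H : 1 - d <= f u \/ 1 - d <= f x ->
    [/\ u i != 0,
      1 - d <= f u -> 1 - e <= l^-1 * component f i (direction x i) &
      1 - d <= f x -> 1 - e <= l^-1 * component f i (direction u i)].
  split=> fz; apply: gap; rewrite ?norm_direction_le1//.
    by have [_ + _] := H (or_introl fz); apply.
  by have [_ _ +] := H (or_intror fz); apply.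
move=> fux.
have mu : m <= `|u i|.
  by apply: le_trans mm0 _; exact: Hm0 fux.
have nu : 0 < `|u i| := lt_le_trans m_gt0 mu.
have ui : u i != 0 by rewrite -normr_gt0.
have near_dir : 2 - d1 <= `|direction u i + direction x i|.
  have -> : d1 = m * d1 / m by rewrite mulrAC divff ?gt_eqF// mul1r.
  by apply: ler_norm_normalised => //; exact: Hdef fux.
have h1 : [set dual_normalize (component f i) | f in
      Phi `&` [set f | 0 < dual_norm (component f i)]]
    (dual_normalize (component f i)) by exists f.
have [Hu Hx] := Hi _ _ (norm_direction ui) h1 near_dir.
have norming z : `|z| = 1 -> m <= `|z i| -> 1 - d <= f z ->
    1 - d1 <= l^-1 * component f i (direction z i).
  move=> z1 mz fz; rewrite ler_pdivlMl//.
  have := component_norming i fb z1 fz; rewrite -/l.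
  rewrite -{2}(directionK z i) linearZ.
  rewrite -[X in _ <= X -> _]/(`|z i| * component f i (direction z i)).
  set A := component f i (direction z i) => lz.
  have nz : 0 < `|z i| by exact: lt_le_trans mz.
  rewrite -(ler_pM2l nz).
  have : e / 2 * m <= l * `|z i| by rewrite ler_pM// ltW.
  by nra.
split => // fz; first by apply: Hu; exact: norming.
by apply: Hx; exact: norming.
Qed.

End CoordinateTransfer.

(** * The modulus of an absolute sum *)

Section AbsoluteSumModulus.
Context {R : realType} {I : Type} {E : abs_normed R I}.
Context (X : I -> completeNormedModType R).

Lemma near0_all_seq (P : I -> R -> Prop) (s : seq I) :
  (forall i, List.In i s -> \forall d \near 0^'+, P i d) ->
  \forall d \near 0^'+, forall i, List.In i s -> P i d.
Proof.
elim: s => [|i s IH] H; first by near=> d => i [].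
have H1 : \forall d \near 0^'+, P i d by apply: H; left.
have H2 : \forall d \near 0^'+, forall i, List.In i s -> P i d.
  by apply: IH => j js; apply: H; right.
by apply: filterS2 H1 H2 => d Pi Ps j [<-//|]; exact: Ps.
Unshelve. all: by end_near. Qed.

(** Transfers the modulus of E along pullbacks, up to the exchange of
    directions on a finite set s outside which x has norm at most r. In both
    implications x is compared with a vector z equal to x on s, which changes
    the value of f by at most 2 r: the bound r <= d1 / 4 lets the modulus of E
    apply to z, and e is spent as e / 4 each for this modulus, the exchanges
    and 2 r. *)
Lemma abs_sum_acs_modulus (x : abs_sum E X)
    (Phi : set {linear abs_sum E X -> R^o}) :
  sluacs_plus (abs_space E) -> dense (unit_span E) -> `|x| = 1 ->
  Phi `<=` dual_ball ->
  (forall i, x i != 0 -> acs_modulus (direction x i)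
    [set dual_normalize (component f i) | f in
      Phi `&` [set f | 0 < dual_norm (component f i)]]) ->
  acs_modulus x Phi.
Proof.
move=> Es dE x1 Phi1 Xx e e0.
have e4 : 0 < e / 4 by rewrite divr_gt0.
have ax1 : `|sum_nrm x| <= 1 by rewrite sum_nrm_norm x1.
have [d1 d10 HE] := near0_pos_ex (sluacs_plus_ball Es ax1 e4).
pose r := Num.min (d1 / 4) (e / 8).
have r0 : 0 < r by rewrite lt_min !divr_gt0.
have [rd re] : r <= d1 / 4 /\ r <= e / 8 by rewrite !ge_min !lexx orbT.
have [s sP] := finite_concentration x dE r0.
(* The successor keeps e' positive when s is empty. *)
pose e' := e / 4 / (size s).+1%:R.
have e'0 : 0 < e' by rewrite divr_gt0.
have se' : (size s)%:R * e' <= e / 4.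
  by rewrite /e' mulrCA -[leRHS]mulr1 ler_pM2l// ler_pdivrMr// mul1r ler_nat.
have tailP (f : {linear abs_sum E X -> R^o}) (y : abs_sum E X) : dual_ball f ->
    (forall j, List.In j s -> y j = x j) -> (forall j, `|y j| <= `|x j|) ->
    `|f x - f y : R| <= 2 * r.
  move=> fb yx yle; rewrite -linearB (le_trans (fb _))//.
  (* The coordinates of x - y are bounded by those of 2 x only. *)
  have -> : x - y = 2 *: (2^-1 *: (x - y)) by rewrite scalerA divff// scale1r.
  rewrite normrZ ger0_norm// ler_wpM2l//; apply: sP => j.
    by move=> /yx js; rewrite sum_fun_scale sum_fun_sub js subrr scaler0.
  rewrite sum_fun_scale sum_fun_sub normrZ ger0_norm ?invr_ge0//.
  by have := ler_normB (x j) (y j); have := yle j; lra.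
have coord : \forall d \near 0^'+, forall i, List.In i s -> x i != 0 ->
    forall u f, `|u| = 1 -> Phi f -> 2 - d <= `|u + x| ->
    (1 - d <= f u -> - e' <= component f i (x i - `|x i| *: direction u i)) /\
    (1 - d <= f x -> - e' <= component f i (u i - `|u i| *: direction x i)).
  apply: near0_all_seq => i _; have [xi|xi] := eqVneq (x i) 0.
    by near=> d.
  have := coordinate_transfer Es x1 Phi1 xi (Xx i xi) e'0.
  by apply: filterS => d Hd _.
have dsmall : \forall d \near (0 : R)^'+, d <= d1 / 2.
  by apply: nbhs_right_le; rewrite divr_gt0.
apply: filterS2 coord dsmall => d coord dd u f u1 Phif ux.
have fb := Phi1 _ Phif.
have {}coord i (si : List.In i s) (xi : x i != 0) :=
  coord i si xi u f u1 Phif ux.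
have aux : 2 - d1 <= `|sum_nrm u + sum_nrm x|.
  by apply: le_trans (norm_add_le x u); lra.
have au1 : `|sum_nrm u| = 1 by rewrite sum_nrm_norm.
(* Coordinates of s with [x j = 0] keep the direction of u: the summands
   have a modulus at unit vectors only, and there z and x both vanish. *)
pose v j := if `[< List.In j s /\ x j != 0 >] then direction x j
            else direction u j.
have v1 j : `|v j| <= 1.
  by rewrite /v; case: ifP => _; exact: norm_direction_le1.
have von j : List.In j s -> x j != 0 -> v j = direction x j.
  by move=> js xj; rewrite /v asboolT.
have voff j : ~ (List.In j s /\ x j != 0) -> v j = direction u j.
  by move=> js; rewrite /v asboolF.
pose z := radial v1 (sum_nrm x).
have zE j : z j = `|x j| *: v j by [].
have xz : `|f x - f z : R| <= 2 * r.
  apply: tailP => // j.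
    rewrite zE; have [->|xj] := eqVneq (x j) 0; first by rewrite normr0 scale0r.
    by move=> /von ->//; rewrite directionK.
  by rewrite zE normrZ normr_id ler_piMr// v1.
have [xz1 xz2] : f x <= f z + 2 * r /\ f z <= f x + 2 * r.
  by move/ler_normlP : xz => [? ?]; split; lra.
split=> fz.
  pose y := radial (norm_direction_le1 u) (sum_nrm x).
  have yE j : y j = `|x j| *: direction u j by [].
  have fy : 1 - e / 4 <= f y.
    apply: (HE _ _ au1 (pullback_dual_ball _ fb) aux).1.
    have -> : pullback f (norm_direction_le1 u) (sum_nrm u) = f u.
      by congr (f _); apply: sum_fun_ext => j /=; rewrite directionK.
    by lra.
  have : f y - (size s)%:R * e' <= f z.
    apply: functional_ge_coordinates; first exact: ltW.
      by move=> j js; rewrite zE yE voff// => -[].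
    move=> j js; rewrite zE yE; have [xj|xj] := eqVneq (x j) 0.
      by rewrite xj normr0 !scale0r subrr linear0 oppr_le0 ltW.
    by rewrite von// directionK; exact: (coord j js xj).1.
  by lra.
pose y := radial v1 (sum_nrm u).
have yE j : y j = `|u j| *: v j by [].
have fy : 1 - e / 4 <= f y.
  apply: (HE _ _ au1 (pullback_dual_ball v1 fb) aux).2.
  by rewrite -[pullback _ _ _]/(f z); lra.
have : f y - (size s)%:R * e' <= f u.
  apply: functional_ge_coordinates; first exact: ltW.
    by move=> j js; rewrite yE voff ?directionK// => -[].
  move=> j js; rewrite yE; have [xj|xj] := eqVneq (x j) 0.
    rewrite voff ?directionK ?subrr ?linear0 ?oppr_le0 ?ltW// => -[_].
    by rewrite xj eqxx.
  by rewrite von//; exact: (coord j js xj).2.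
by lra.
Unshelve. all: by end_near. Qed.

End AbsoluteSumModulus.

Theorem proposition3p8 (R : realType) (I : Type) (I_nonempty : inhabited I)
    (E : abs_normed R I) (span_dense : dense (unit_span E))
    (X : I -> completeNormedModType R)
    (E_sluacs : sluacs_plus (abs_space E)) :
  ((forall i, sluacs_plus (X i)) -> sluacs_plus (abs_sum E X)) /\
  ((forall i, luacs_plus (X i)) -> luacs_plus (abs_sum E X)).
Proof.
split=> Xacs.
  apply/sluacs_plusP => x x1.
  apply: abs_sum_acs_modulus => // [f|i xi]; first exact: dual_sphere_ball.
  have := (sluacs_plusP (X := X i)).1 (Xacs i) _ (norm_direction xi).
  apply: sub_acs_modulus => _ [f [/dual_sphere_ball fb f0] <-].
  exact: dual_normalize_sphere (component_dual_ball fb) f0.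
apply/luacs_plusP => x f x1 fs; have fb := dual_sphere_ball fs.
apply: abs_sum_acs_modulus => // [g ->//|i xi].
have [f0|f0] := ltP 0 (dual_norm (component f i)); last first.
  apply: (sub_acs_modulus (Psi := set0)) => [h [g [-> /=]]|e e0].
    by rewrite ltNge f0.
  by near=> d.
have hs := dual_normalize_sphere (component_dual_ball fb) f0.
have := (luacs_plusP (X := X i)).1 (Xacs i) _ _ (norm_direction xi) hs.
by apply: sub_acs_modulus => _ [g [-> _] <-].
Unshelve. all: by end_near. Qed.
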